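(* For $n\in\mathbb Z$, the A-polynomial $A_{2n}=A_{2n}(L,M)$ of the twist knot $T_{2n}$ is given recursively by $$A_{2n}=\begin{cases}A_u\,A_{2(n-1)}-M^4(1+LM^2)^4A_{2(n-2)}, & n>1,\\ A_u\,A_{2(n+1)}-M^4(1+LM^2)^4A_{2(n+2)}, & n<-2,\end{cases}$$ with initial conditions $$\begin{aligned} A_{-4}(L,M)=\ &1-L+2LM^2+2LM^4+L^2M^4-L^2M^6-LM^8+LM^{10}+2L^2M^{10}\\&+2L^2M^{12}-L^2M^{14}+L^3M^{14},\\ A_{-2}(L,M)=\ &1+LM^6,\\ A_0(L,M)=\ &-1,\\ A_2(L,M)=\ &L-LM^2-M^4-2LM^4-L^2M^4-LM^6+LM^8, \end{aligned}$$ where $$A_u=1-L+2LM^2+M^4+2LM^4+L^2M^4+2LM^6-LM^8+L^2M^8.$$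
   Context: $T_m$ is the twist knot having a regular planar projection with 2 left-handed vertical crossings (the clasp) and $m$ right-handed horizontal crossings (the twist region; negative $m$ means crossings of the opposite handedness); $T_{2n}$ is the two-bridge knot of slope $2/(4n+1)$. Its exterior $X_{2n}$ has $\pi_1(X_{2n})=\langle s,t\mid swt^{-1}w^{-1}=1\rangle$, $w=(ts^{-1}t^{-1}s)^n$, with $s,t$ meridians. The canonical (null-homologous) longitude commuting with $s$ is $\ell=ww^*$, where $w^*=(st^{-1}s^{-1}t)^n$ is the word $w$ read backwards. The A-polynomial is computed using the representations $\eta':\pi_1(X_{2n})\to SL(2,\mathbb C)$ of the form $\eta'(s)=\begin{pmatrix}M&1\\0&M^{-1}\end{pmatrix}$, $\eta'(t)=\begin{pmatrix}M&0\\ y&M^{-1}\end{pmatrix}$. For a nonabelian such representation, $L$ denotes the upper-left entry (eigenvalue) of the upper triangular matrix $\eta'(\ell)$. The A-polynomial $A_{2n}(L,M)\in\mathbb Z[L,M]$ is the polynomial (with coprime integer coefficients and no repeated factors, well defined up to sign) defining the Zariski closure of the set of pairs $(L,M)$ arising from nonabelian representations; the factor $L-1$ coming from abelian representations is not included, and $A_0$ is a unit. The formulas in the claim fix the sign. *)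

(* Defs.v *)
From mathcomp Require Import all_boot all_order all_algebra.
From mathcomp Require Export complex reals.

Set Implicit Arguments.
Unset Strict Implicit.
Unset Printing Implicit Defensive.

Import Order.TTheory GRing.Theory Num.Theory.

Local Open Scope ring_scope.

(* An element of a group generated by s and t is written as a word in the
   letters s, t and their inverses; the letter (g, true) stands for g^-1. *)
Variant generator := gen_s | gen_t.
Definition letter : Type := generator * bool.
Definition word : Type := seq letter.

Definition ws : word := [:: (gen_s, false)].
Definition wt : word := [:: (gen_t, false)].

Definition winv (u : word) : word := rev [seq (x.1, ~~ x.2) | x <- u].

Definition wpow (u : word) (n : int) : word :=
  match n with
  | Posz k => flatten (nseq k u)
  | Negz k => flatten (nseq k.+1 (winv u))
  end.

(* w = (t s^-1 t^-1 s)^n *)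
Definition twist_w (n : int) : word := wpow (wt ++ winv ws ++ winv wt ++ ws) n.

(* w^* = (s t^-1 s^-1 t)^n *)
Definition twist_wstar (n : int) : word :=
  wpow (ws ++ winv wt ++ winv ws ++ wt) n.

(* s w t^-1 w^-1, so that pi_1(X_2n) = < s, t | twist_relator n > *)
Definition twist_relator (n : int) : word :=
  ws ++ twist_w n ++ winv wt ++ winv (twist_w n).

Definition twist_longitude (n : int) : word := twist_w n ++ twist_wstar n.

Lemma rev_flatten_nseq (T : Type) (k : nat) (u : seq T) :
  rev (flatten (nseq k u)) = flatten (nseq k (rev u)).
Proof.
elim: k => //= k IHk; rewrite rev_cat IHk.
by elim: k {IHk} => /= [|k IHk]; rewrite ?cats0 // -catA IHk.
Qed.

Lemma twist_wstarE (n : int) : twist_wstar n = rev (twist_w n).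
Proof. by case: n => k; rewrite /twist_w /wpow rev_flatten_nseq. Qed.

Section APolynomial.

Variable K : fieldType.
Implicit Types (l m y : K) (eta : word -> 'M[K]_2).

(* A representation of < s, t | twist_relator n > in SL_2(K), given on words:
   a homomorphism from the free group on s and t that kills the relator. *)
Definition is_SL2_representation (n : int) eta : Prop :=
  [/\ forall u, \det (eta u) = 1,
      forall u v, eta (u ++ v) = eta u *m eta v,
      forall u, eta (winv u) = invmx (eta u)
    & eta (twist_relator n) = 1%:M].

Definition nonabelian_representation eta : Prop :=
  exists u v, eta u *m eta v <> eta v *m eta u.

Definition mx22 (a b c d : K) : 'M[K]_2 :=
  \matrix_(i, j) if i == 0 then (if j == 0 then a else b)
                 else (if j == 0 then c else d).

(* Only m != 0 can occur, since eta ws has determinant 1 and 0^-1 = 0. *)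
Definition eigenvalue_pair (n : int) l m : Prop :=
  exists eta y,
    [/\ is_SL2_representation n eta, nonabelian_representation eta,
        eta ws = mx22 m 1 0 m^-1, eta wt = mx22 m 0 y m^-1
      & l = eta (twist_longitude n) 0 0].

(* Bivariate polynomials in (L, M) are elements of {poly {poly _}} with
   L = 'X the outer variable and M = 'Y the inner one, and p.[l, m] is the
   value of p at L = l, M = m. *)
Definition zariski_closure (D : K -> K -> Prop) l m : Prop :=
  forall f : {poly {poly K}},
    (forall l' m', D l' m' -> f.[l', m'] = 0) -> f.[l, m] = 0.

Definition coprime_coefficients (A : {poly {poly int}}) : Prop :=
  forall d : int, (forall i j : nat, (d %| A`_i`_j)%Z) -> `|d| = 1.

Definition no_repeated_factor (A : {poly {poly int}}) : Prop :=
  forall B C : {poly {poly int}}, A = B ^+ 2 * C -> B \is a GRing.unit.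

(* A is the A-polynomial of T_2n, which is determined only up to sign. *)
Definition is_A_polynomial (n : int) (A : {poly {poly int}}) : Prop :=
  [/\ coprime_coefficients A,
      no_repeated_factor A
    & forall l m, (map_poly (map_poly intr) A).[l, m] = 0 <->
                  zariski_closure (eigenvalue_pair n) l m].

End APolynomial.

(* Main.v *)
(* Write y for the lower left entry of t and c for the matrix of t s^-1 t^-1 s, delta = (M - 1/M)^2 and
   tau = tr c = 2 + delta y + y^2. By Cayley-Hamilton w = U_n(tau) c - U_(n-1)(tau)
   with U a Chebyshev sequence, and s w = w t reduces to one equation, the Riley
   polynomial r_n(delta, y) = U_(n+1) - (1 + y + delta) U_n = 0. On this curve
   L = - c_12(1/M, y) / c_12(M, y), a Moebius function of y, whose inverse is
   y = (M^2 - 1) (L - 1) / (1 + L M^2). Substituting it into r_n and clearing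
   denominators turns the three-term recursion of U into that of A_2n.

   The reducedness of A_2n and the closure statement both follow by counting: for
   infinitely many M the polynomial A_2n(., M) has as many distinct roots coming
   from representations as its degree. Indeed r_n has distinct roots in y for
   delta = -4 (the dihedral representations), hence for almost all delta. Factors
   depending on M alone are excluded since the leading coefficient of A_2n in L is
   a power of M up to sign, while A_2n mod M has a coefficient +1 or -1. *)

Require Import Defs.
From mathcomp Require Import all_boot all_order all_algebra.
From mathcomp Require Import separable complex reals ring.

Set Implicit Arguments.
Unset Strict Implicit.
Unset Printing Implicit Defensive.

Import Order.TTheory GRing.Theory Num.Theory.

Local Open Scope ring_scope.

(** * Recognizing an A-polynomial *)

Lemma horner2E (K : comNzRingType) (f : {poly {poly K}}) (l m : K) :
  f.[l, m] = (map_poly (horner_eval m) f).[l].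
Proof.
by have /esym := horner_map (horner_eval m) f l%:P; rewrite /= /horner_eval hornerC.
Qed.

(** Infinitude is expressed as escaping every finite list, here the list of roots of [p]. *)
Lemma poly_infinite_roots_eq0 (K : closedFieldType) (p : {poly K})
    (P : K -> Prop) :
  (forall s : seq K, exists2 m, m \notin s & P m) ->
  (forall m, P m -> p.[m] = 0) -> p = 0.
Proof.
move=> infP pP; have [->//|p0] := eqVneq p 0.
have [r pE] := closed_field_poly_normal p.
have [m mr /pP pm] := infP r.
move/eqP: pm; rewrite pE hornerZ mulf_eq0 lead_coef_eq0 (negPf p0) /=.
by rewrite -rootE root_prod_XsubC (negPf mr).
Qed.

Lemma poly2_infinite_eq0 (K : closedFieldType) (p : {poly {poly K}})
    (P : K -> Prop) :
  (forall s : seq K, exists2 m, m \notin s & P m) ->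
  (forall m, P m -> map_poly (horner_eval m) p = 0) -> p = 0.
Proof.
move=> infP pP; apply/polyP => i; rewrite coef0.
apply: (poly_infinite_roots_eq0 infP) => m /pP /polyP/(_ i).
by rewrite coef_map coef0.
Qed.

(** Here the scalar ['X] is the variable M of the coefficients. It is prime and does not divide [A],
    so it divides [q], and the powers of M cancel one at a time. *)
Lemma polyX_scale_cancel (K : idomainType) (N : nat)
    (f q A : {poly {poly K}}) :
  map_poly (horner_eval 0) A != 0 -> 'X^N *: f = q * A ->
  exists q', f = q' * A.
Proof.
move=> A0; elim: N f q => [|N IHN] f q; first by rewrite scale1r; exists q.
move=> E.
have q0 : map_poly (horner_eval 0) q = 0.
  move: E => /(congr1 (map_poly (horner_eval 0))); rewrite rmorphM /= map_polyZ.
  rewrite /= /horner_eval exprS hornerM hornerX mul0r scale0r => /esym/eqP.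
  by rewrite mulf_eq0 (negPf A0) orbF => /eqP.
(* The coefficients of [q] vanish at M = 0, so shifting each of them down by one degree divides it
   by M. *)
have qE : q = 'X *: map_poly (drop_poly 1) q.
  apply/polyP => i; rewrite coefZ coef_map_id0 ?drop_poly0r //.
  rewrite -[LHS](poly_take_drop 1) expr1 mulrC [X in X + _](_ : _ = 0) ?add0r //.
  apply/polyP => -[|j]; rewrite coef_take_poly coef0 //=.
  move: q0 => /polyP/(_ i).
  by rewrite coef_map coef0 /= /horner_eval horner_coef0.
have X0 : ('X : {poly K}) != 0 by rewrite polyX_eq0.
apply: (IHN _ (map_poly (drop_poly 1) q)).
apply/polyP => j; apply: (mulfI X0); rewrite -!coefZ; congr (_`_j).
by rewrite scalerA -exprS E {1}qE scalerAl.
Qed.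

(** The prime ['X] does not divide [b], so all [N] factors ['X] come out of [c], until [b] divides a
    sign. *)
Lemma factor_XnN_unit (b c : {poly int}) (N : nat) (u : bool) :
  b * c = (-1) ^+ u * 'X^N -> b.[0] != 0 -> b \is a GRing.unit.
Proof.
move=> E b0; elim: N c E => [|N IHN] c E.
  have : b * c \is a GRing.unit by rewrite E mulr1 unitrX // unitrN1.
  by rewrite unitrM => /andP[].
have : c.[0] = 0.
  move: E => /(congr1 (horner^~ 0)); rewrite !hornerM hornerXn expr0n mulr0.
  by move/eqP; rewrite mulf_eq0 (negPf b0) => /eqP.
move=> /rootP /factor_theorem [c']; rewrite polyC0 subr0 => cE.
apply: (IHN c'); have X0 : ('X : {poly int}) != 0 by rewrite polyX_eq0.
apply: (mulIf X0).
by rewrite -mulrA -cE E exprSr mulrA.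
Qed.

(** For each good [m] the specialization of [A] splits into distinct linear factors, one for each
    eigenvalue in [rs]. What is checked there passes to K[M][L], as there are infinitely many such
    [m]; the two coefficient hypotheses control factors in M alone. *)
Lemma is_A_polynomial_criterion (K : numClosedFieldType) (n : int)
    (A : {poly {poly int}}) (N i : nat) (u v : bool) :
  lead_coef A = (-1) ^+ u * 'X^N -> A`_i`_0 = (-1) ^+ v ->
  (forall l m : K, eigenvalue_pair n l m ->
     (map_poly (map_poly intr) A).[l, m] = 0) ->
  (forall s : seq K, exists2 m, m \notin s &
     m != 0 /\ exists rs : seq K, [/\ uniq rs, size rs = (size A).-1
       & forall l, l \in rs -> eigenvalue_pair n l m]) ->
  is_A_polynomial K n A.
Proof.
move=> Alead Ai DA generic.
pose good m := m != 0 /\ exists rs : seq K, [/\ uniq rs, size rs = (size A).-1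
  & forall l, l \in rs -> eigenvalue_pair n l m].
set AK := map_poly (map_poly intr) A in DA *.
have injZ : injective (intr : int -> K) by apply: intr_inj.
have injZX : injective (map_poly intr : {poly int} -> {poly K}).
  exact: map_inj_poly.
have lAK : lead_coef AK = (-1) ^+ u * 'X^N.
  rewrite lead_coef_map_inj //; last exact: rmorph0.
  by rewrite Alead rmorphM rmorph_sign /= map_polyXn.
have sAK : size AK = size A by rewrite size_map_inj_poly ?rmorph0.
have A_neq0 : A != 0.
  apply/eqP => A0; move: Ai; rewrite A0 !coef0 => /eqP.
  by rewrite eq_sym signr_eq0.
have AK0 : map_poly (horner_eval 0) AK != 0.
  apply/eqP => /polyP/(_ i); rewrite coef_map /= coef_map /=.
  rewrite /horner_eval horner_coef0 coef_map /= Ai rmorph_sign coef0.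
  by move=> /eqP; rewrite signr_eq0.
have lm m : m != 0 -> (lead_coef AK).[m] != 0.
  move=> m0; rewrite lAK hornerM hornerXn horner_exp hornerN hornerC.
  by rewrite mulf_neq0 ?expf_neq0 // oppr_eq0 oner_eq0.
have Am m (rs : seq K) : m != 0 -> uniq rs -> size rs = (size A).-1 ->
    (forall l, l \in rs -> eigenvalue_pair n l m) ->
    map_poly (horner_eval m) AK =
      (lead_coef AK).[m] *: \prod_(z <- rs) ('X - z%:P).
  move=> m0 rs_uniq rs_size rsD.
  rewrite [LHS](@all_roots_prod_XsubC _ _ rs) ?uniq_rootsE //.
  - by rewrite lead_coef_map_eq // lm.
  - by rewrite size_map_poly_id0 ?lm // sAK rs_size prednK // size_poly_gt0.
  - by apply/allP => l /rsD /DA; rewrite horner2E => /rootP.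
split.
- move=> d /(_ i 0%N); rewrite Ai => /dvdzP[q] /(congr1 Num.norm).
  rewrite normrM normr_sign => /esym/eqP.
  by rewrite -abszE -[in X in X -> _]abszE -PoszM eqz_nat muln_eq1 => /andP[_ /eqP->].
- move=> B C ABC.
  pose BK := map_poly (map_poly intr) B : {poly {poly K}}.
  pose CK := map_poly (map_poly intr) C : {poly {poly K}}.
  (* [drop_poly 1 BK] collects the coefficients of positive degree in L. A polynomial whose square
     divides a separable one is constant, so they vanish at every good [m]. *)
  have BK1 : (drop_poly 1 BK) = 0.
    apply: (@poly2_infinite_eq0 _ _ good generic) => m [m0 [rs [rs_uniq rs_size rsD]]].
    have AmE := Am m rs m0 rs_uniq rs_size rsD.
    have ABCm : map_poly (horner_eval m) AK =
        map_poly (horner_eval m) BK * map_poly (horner_eval m) BK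
          * map_poly (horner_eval m) CK.
      by rewrite /AK ABC expr2 !rmorphM.
    have : separable_poly (map_poly (horner_eval m) AK).
      rewrite AmE (eqp_separable (eqp_scale _ (lm m m0))).
      by rewrite separable_prod_XsubC.
    rewrite ABCm => /separable_coprime/(_ (dvdp_mulr _ (dvdpp _))).
    rewrite coprimepp => sB.
    have sB1 : (size (map_poly (horner_eval m) BK) <= 1)%N by rewrite (eqP sB).
    apply/polyP => j; rewrite coef_map /= coef_drop_poly coef0.
    by rewrite -[LHS]/((horner_eval m) BK`_(j + 1)) -coef_map nth_default //
      (leq_trans sB1) // addn1.
  have BE : B = (B`_0)%:P.
    apply/polyP => -[|j]; rewrite coefC //=.
    apply: injZX; rewrite rmorph0.
    move: BK1 => /polyP/(_ j).
    by rewrite coef_drop_poly coef0 coef_map addn1.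
  have b0 : (B`_0).[0] != 0.
    apply/eqP => b0; move: Ai; rewrite ABC BE -polyC_exp coefCM -horner_coef0.
    rewrite hornerM horner_exp b0 expr0n /= mul0r => /eqP.
    by rewrite eq_sym signr_eq0.
  (* [B] is now a polynomial in M alone, prime to M by [b0], and it divides the leading coefficient
     of [A], a power of M up to sign. *)
  rewrite BE; apply: rmorph_unit.
  apply: (@factor_XnN_unit _ (B`_0 * lead_coef C) N u) => //.
  rewrite -Alead ABC {3}BE lead_coefM -polyC_exp lead_coefC.
  by rewrite mulrA expr2.
- move=> l m; split=> [Alm f fD|]; last by move=> /(_ AK); apply; exact: DA.
  suff [q ->] : exists q, f = q * AK by rewrite !hornerM Alm mulr0.
  (* The pseudo-remainder has lower degree in L than [A], yet at each good [z] it vanishes on the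
     list [rs], whose length is the degree of [A]. *)
  have r0 : f %% AK = 0.
    apply: (@poly2_infinite_eq0 _ _ good generic) => z [z0 [rs [rs_uniq rs_size rsD]]].
    apply: (@roots_geq_poly_eq0 _ _ rs) => //.
      apply/allP => l' /rsD Dl'; apply/rootP.
      have := Pdiv.Idomain.divp_eq f AK => /(congr1 (fun p => p.[l', z])).
      rewrite !hornerE fD // DA // !mulr0 add0r horner2E => /esym.
      exact.
    have : (size (f %% AK)%R < size A)%N.
      by rewrite -sAK Pdiv.Idomain.ltn_modp -size_poly_gt0 sAK size_poly_gt0.
    move=> sr; rewrite rs_size -ltnS prednK ?size_poly_gt0 //.
    by apply: leq_ltn_trans sr; rewrite size_poly.
  (* Pseudo-division has multiplied [f] by a power of the leading coefficient; the sign moves to the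
     quotient and the power of M is cancelled. *)
  pose k := scalp f AK.
  have E : 'X^(N * k) *: f = ((-1) ^+ (u * k) *: (f %/ AK)) * AK.
    have := Pdiv.Idomain.divp_eq f AK; rewrite r0 addr0 lAK -/k => fE.
    rewrite -scalerAl -fE scalerA exprMn mulrA -exprM -exprD addnn -muln2.
    by rewrite [_ ^+ (_ * 2)]exprM sqrr_sign mul1r exprM.
  exact: polyX_scale_cancel AK0 E.
Qed.

(** * Representations of the twist knot group *)

(** The Lucas sequence U_k(a, b): b = 1 gives the Chebyshev sequence, and b = M^4 (1 + L M^2)^4 the
    recursion of the A-polynomials. *)
Fixpoint lucas (R : comNzRingType) (a b : R) (k : nat) : R :=
  if k is k1.+1 then
    if k1 is k2.+1 then a * lucas a b k1 - b * lucas a b k2 else 1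
  else 0.

(** Negative indices follow U_(-k) = - U_k, where [Negz k] stands for -(k+1). *)
Definition chebyshev (R : comNzRingType) (tau : R) (n : int) : R :=
  match n with
  | Posz k => lucas tau 1 k
  | Negz k => - lucas tau 1 k.+1
  end.

Definition commutator_trace (R : comNzRingType) (delta y : R) : R :=
  2 + delta * y + y ^+ 2.

(* With tau = tr [t, s^-1] and w = U_n c - U_(n-1), the relation s w = w t is the
   vanishing of this polynomial. *)
Definition riley (R : comNzRingType) (delta y : R) (n : int) : R :=
  let tau := commutator_trace delta y in
  chebyshev tau (n + 1) - (1 + y + delta) * chebyshev tau n.

Lemma lucasSS (R : comNzRingType) (a b : R) (k : nat) :
  lucas a b k.+2 = a * lucas a b k.+1 - b * lucas a b k.
Proof. by []. Qed.

Lemma NegzB1 (k : nat) : Negz k - 1 = Negz k.+1.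
Proof. by rewrite !NegzE -opprD -PoszD addn1. Qed.

Lemma NegzD1 (k : nat) : Negz k.+1 + 1 = Negz k.
Proof. by rewrite -NegzB1 addrNK. Qed.

Lemma chebyshevD1 (R : comNzRingType) (tau : R) (n : int) :
  chebyshev tau (n + 1) = tau * chebyshev tau n - chebyshev tau (n - 1).
Proof.
case: n => [[|k]|[|k]].
- by rewrite add0r sub0r /=; ring.
- by rewrite -PoszD addn1 subzSS subr0 [LHS]lucasSS mul1r.
- by rewrite /=; ring.
- rewrite NegzD1 NegzB1 /chebyshev (lucasSS _ _ k.+1).
  by move: (lucas _ _ k.+2) (lucas _ _ k.+1) => x y; ring.
Qed.

(** For a matrix c of trace [tau] and determinant 1, the left-hand side is the determinant of c^n =
    U_n c - U_(n-1). *)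
Lemma chebyshev_quadratic (R : comNzRingType) (tau : R) (n : int) :
  let a := chebyshev tau n in let b := chebyshev tau (n - 1) in
  a ^+ 2 - tau * a * b + b ^+ 2 = 1.
Proof.
have H (k : nat) : lucas tau 1 k.+1 ^+ 2 - tau * lucas tau 1 k.+1 * lucas tau 1 k
    + lucas tau 1 k ^+ 2 = 1.
  elim: k => [|k IHk]; first by rewrite /=; ring.
  rewrite -[RHS]IHk lucasSS.
  by move: (lucas _ _ k.+1) (lucas _ _ k) => x y; ring.
case: n => [[|k]|k] a b.
- by rewrite /a /b /=; ring.
- by rewrite /a /b subzSS subr0 H.
- rewrite /a /b NegzB1 -[RHS](H k.+1) /chebyshev.
  by move: (lucas _ _ k.+2) (lucas _ _ k.+1) => x y; ring.
Qed.

Lemma expmx_lucas (K : fieldType) (tau : K) (C : 'M[K]_2) (k : nat) :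
  C * C = tau *: C - 1 ->
  C ^+ k.+1 = lucas tau 1 k.+1 *: C - lucas tau 1 k *: 1.
Proof.
move=> C_sqr; elim: k => [|k IHk]; first by rewrite expr1 /= scale1r scale0r subr0.
rewrite exprS IHk mulrBr -!scalerAr C_sqr mulr1 lucasSS mul1r.
rewrite scalerBr scalerA scalerBl [lucas _ _ _ * tau]mulrC.
by rewrite -!addrA; congr (_ + _); rewrite addrC.
Qed.

(** The inverse [tau - eta u] satisfies the same quadratic relation as [eta u], so negative powers
    follow from the formula for positive ones. *)
Lemma word_hom_wpow (K : fieldType) (eta : word -> 'M[K]_2) (tau : K) (u : word)
    (n : int) :
  eta [::] = 1 -> (forall v w, eta (v ++ w) = eta v * eta w) ->
  eta u * eta u = tau *: eta u - 1 -> eta (winv u) = tau *: 1 - eta u ->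
  eta (wpow u n) = chebyshev tau n *: eta u - chebyshev tau (n - 1) *: 1.
Proof.
move=> eta1 etaM sqr_u inv_u.
have etaX v k : eta (flatten (nseq k v)) = eta v ^+ k.
  by elim: k => //= k IHk; rewrite etaM IHk exprS.
case: n => [[|k]|k]; rewrite /wpow etaX.
- by rewrite expr0 /= scale0r scaleN1r opprK add0r.
- by rewrite (expmx_lucas _ sqr_u) subzSS subr0.
- rewrite (@expmx_lucas _ tau) inv_u.
    rewrite NegzB1 /chebyshev lucasSS mul1r scalerBr scalerA !scaleNr scalerBl.
    by rewrite [_ * tau]mulrC opprK addrAC addrC.
  rewrite mulrBl !mulrBr sqr_u -!scalerAr -!scalerAl !mul1r !mulr1 scalerBr.
  by rewrite opprB [X in _ + X]addrAC subrr add0r.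
Qed.

(** * Two-by-two matrices *)

Lemma mulmx22 (K : fieldType) (a b c d a' b' c' d' : K) :
  mx22 a b c d * mx22 a' b' c' d' =
  mx22 (a * a' + b * c') (a * b' + b * d') (c * a' + d * c') (c * b' + d * d').
Proof.
apply/matrixP => i j; rewrite /mx22 !mxE !big_ord_recl big_ord0 !mxE addr0.
by case: (i == 0); case: (j == 0).
Qed.

Lemma mx22D (K : fieldType) (a b c d a' b' c' d' : K) :
  mx22 a b c d + mx22 a' b' c' d' = mx22 (a + a') (b + b') (c + c') (d + d').
Proof. by apply/matrixP => i j; rewrite !mxE; do 2![case: ifP]. Qed.

Lemma mx22N (K : fieldType) (a b c d : K) :
  - mx22 a b c d = mx22 (- a) (- b) (- c) (- d).
Proof. by apply/matrixP => i j; rewrite !mxE; do 2![case: ifP]. Qed.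

Lemma mx22Z (K : fieldType) (x a b c d : K) :
  x *: mx22 a b c d = mx22 (x * a) (x * b) (x * c) (x * d).
Proof. by apply/matrixP => i j; rewrite !mxE; do 2![case: ifP]. Qed.

Lemma mx22_1 (K : fieldType) : 1 = mx22 1 0 0 1 :> 'M[K]_2.
Proof.
apply/matrixP => i j; rewrite !mxE.
by case: i => [[|[|i]] Hi]; case: j => [[|[|j]] Hj].
Qed.

Lemma det_mx22 (K : fieldType) (a b c d : K) :
  \det (mx22 a b c d) = a * d - b * c.
Proof.
rewrite (expand_det_row _ 0) !big_ord_recl big_ord0 /cofactor !det_mx11 !mxE /=.
by rewrite expr0 expr1; ring.
Qed.

Lemma mx22_inj (K : fieldType) (a b c d a' b' c' d' : K) :
  mx22 a b c d = mx22 a' b' c' d' -> [/\ a = a', b = b', c = c' & d = d'].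
Proof.
move=> /matrixP E; split.
- by have := E 0 0; rewrite !mxE.
- by have := E 0 1; rewrite !mxE.
- by have := E 1 0; rewrite !mxE.
- by have := E 1 1; rewrite !mxE.
Qed.

Lemma invmx22 (K : fieldType) (a b c d : K) :
  a * d - b * c = 1 -> invmx (mx22 a b c d) = mx22 d (- b) (- c) a.
Proof.
move=> det1.
have U : mx22 a b c d \in unitmx by rewrite unitmxE det_mx22 det1 unitr1.
rewrite -[RHS](mulKmx U) -[_ *m mx22 d _ _ _]/(_ * _) mulmx22.
rewrite [X in _ *m X](_ : _ = 1) ?mulmx1 // mx22_1 -det1.
by congr mx22; ring.
Qed.

(* The (1,2)-entry of t s^-1 t^-1 s; that of s t^-1 s^-1 t is obtained by
   exchanging m and m^-1. *)
Definition corner (K : fieldType) (m y : K) : K := m^-1 - m + m * y.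

(** Once U_(n-1) = g U_n, the determinant identity reads U_n^2 (1 - tau g + g^2) = 1, and its middle
    factor is divisible by [corner m y]. The cofactor is the one that appears in the longitude. *)
Lemma riley_root_quadratic (K : fieldType) (m y : K) (n : int) :
  let delta := (m - m^-1) ^+ 2 in
  let g := commutator_trace delta y - 1 - y - delta in
  m != 0 -> riley delta y n = 0 ->
  chebyshev (commutator_trace delta y) (n - 1) =
    g * chebyshev (commutator_trace delta y) n /\
  chebyshev (commutator_trace delta y) n ^+ 2 *
    ((1 + y * m ^+ 2 - g) * (m - m^-1) + y * corner m y) * corner m y = - 1.
Proof.
move=> delta; set tau := commutator_trace _ _ => g m0 r0.
have bE : chebyshev tau (n - 1) = g * chebyshev tau n.
  apply/eqP; rewrite eq_sym -subr_eq0 -r0 /riley -/tau chebyshevD1 /g.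
  by apply/eqP; ring.
split=> //; have := chebyshev_quadratic tau n; rewrite /= bE => quad.
by rewrite -[in RHS]quad /g /tau /commutator_trace /delta /corner; field.
Qed.

Lemma riley_root_corner_neq0 (K : fieldType) (m y : K) (n : int) :
  m != 0 -> riley ((m - m^-1) ^+ 2) y n = 0 -> corner m y != 0.
Proof.
move=> m0 /(riley_root_quadratic m0) [_]; apply: contra_eq_neq => ->.
by rewrite mulr0 eq_sym oppr_eq0 oner_eq0.
Qed.

(** * Values of a representation on the twist words *)

Section Evaluation.

Variables (K : fieldType) (m y : K) (eta : word -> 'M[K]_2).
Hypothesis m_neq0 : m != 0.
Hypothesis eta_det : forall u, \det (eta u) = 1.
Hypothesis etaM : forall u v, eta (u ++ v) = eta u * eta v.
Hypothesis etaV : forall u, eta (winv u) = invmx (eta u).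
Hypothesis eta_s : eta ws = mx22 m 1 0 m^-1.
Hypothesis eta_t : eta wt = mx22 m 0 y m^-1.

Let delta := (m - m^-1) ^+ 2.
Let tau := commutator_trace delta y.

Lemma eta_unit u : eta u \in unitmx.
Proof. by rewrite unitmxE eta_det unitr1. Qed.

Lemma eta_nil : eta [::] = 1.
Proof.
by rewrite -[LHS](mulKmx (eta_unit [::])) -[eta [::] *m _]etaM mulVmx ?eta_unit.
Qed.

Lemma eta_sV : eta (winv ws) = mx22 m^-1 (- 1) 0 m.
Proof. by rewrite etaV eta_s invmx22 ?oppr0 ?mulfV //; field. Qed.

Lemma eta_tV : eta (winv wt) = mx22 m^-1 0 (- y) m.
Proof. by rewrite etaV eta_t invmx22 ?oppr0 ?mulfV //; field. Qed.

Lemma eta_w n :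
  let a := chebyshev tau n in let b := chebyshev tau (n - 1) in
  eta (twist_w n) =
    mx22 (a * (1 + y * m ^+ 2) - b) (a * corner m y)
         (a * (y * corner m y)) (a * (y * m^-1 ^+ 2 + (1 - y) ^+ 2) - b).
Proof.
have cE : eta (wt ++ winv ws ++ winv wt ++ ws) =
    mx22 (1 + y * m ^+ 2) (corner m y)
         (y * corner m y) (y * m^-1 ^+ 2 + (1 - y) ^+ 2).
  rewrite !etaM eta_s eta_t eta_sV eta_tV !mulmx22 /corner.
  by congr mx22; field.
rewrite /twist_w (word_hom_wpow (tau := tau) _ eta_nil etaM).
- by rewrite cE mx22_1 !mx22Z mx22N mx22D; congr mx22; ring.
- rewrite cE mx22_1 mulmx22 !mx22Z mx22N mx22D /tau /commutator_trace /delta /corner.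
  by congr mx22; field.
- rewrite etaV cE invmx22; last by rewrite /corner; field.
  rewrite mx22_1 !mx22Z mx22N mx22D /tau /commutator_trace /delta /corner.
  by congr mx22; field.
Qed.

Lemma eta_wstar n :
  let a := chebyshev tau n in let b := chebyshev tau (n - 1) in
  eta (twist_wstar n) =
    mx22 (a * (y * m ^+ 2 + (1 - y) ^+ 2) - b) (a * corner m^-1 y)
         (a * (y * corner m^-1 y)) (a * (1 + y * m^-1 ^+ 2) - b).
Proof.
have cE : eta (ws ++ winv wt ++ winv ws ++ wt) =
    mx22 (y * m ^+ 2 + (1 - y) ^+ 2) (corner m^-1 y)
         (y * corner m^-1 y) (1 + y * m^-1 ^+ 2).
  rewrite !etaM eta_s eta_t eta_sV eta_tV !mulmx22 /corner invrK.
  by congr mx22; field.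
rewrite /twist_wstar (word_hom_wpow (tau := tau) _ eta_nil etaM).
- by rewrite cE mx22_1 !mx22Z mx22N mx22D; congr mx22; ring.
- rewrite cE mx22_1 mulmx22 !mx22Z mx22N mx22D /tau /commutator_trace /delta.
  by rewrite /corner invrK; congr mx22; field.
- rewrite etaV cE invmx22; last by rewrite /corner invrK; field.
  rewrite mx22_1 !mx22Z mx22N mx22D /tau /commutator_trace /delta /corner invrK.
  by congr mx22; field.
Qed.

(** In s w = w t the diagonal entries agree identically; the difference of the (1,2) entries is the
    Riley polynomial, and that of the (2,1) entries is -y times it. *)
Lemma relatorP n : eta (twist_relator n) = 1 <-> riley delta y n = 0.
Proof.
set a := chebyshev tau n; set b := chebyshev tau (n - 1).
have rE : riley delta y n = (tau - 1 - y - delta) * a - b.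
  by rewrite /riley -/tau chebyshevD1 -/a -/b; ring.
have -> : eta (twist_relator n) = 1 <->
    eta ws * eta (twist_w n) = eta (twist_w n) * eta wt.
  rewrite /twist_relator !etaM !etaV !mulrA.
  rewrite -[invmx (eta wt)]/((eta wt)^-1).
  rewrite -[invmx (eta (twist_w n))]/((eta (twist_w n))^-1).
  split=> [E|->].
    have := congr1 (fun X => X * eta (twist_w n) * eta wt) E.
    by rewrite mul1r !mulrVK // ?eta_unit.
  by rewrite mulrK ?eta_unit // mulrV ?eta_unit.
rewrite eta_w -/a -/b eta_s eta_t !mulmx22 rE /tau /commutator_trace /delta /corner.
split=> [/mx22_inj[_ /eqP E _ _]|/eqP].
  by apply/eqP; move: E; rewrite -subr_eq0; congr (_ == 0); field.
by rewrite subr_eq0 => /eqP <-; congr mx22; field.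
Qed.

(** The eigenvalue is [h * corner m^-1 y], and [h * corner m y = -1] by the determinant identity. *)
Lemma longitude_corner n : riley delta y n = 0 ->
  eta (twist_longitude n) 0 0 * corner m y + corner m^-1 y = 0.
Proof.
move=> /(riley_root_quadratic m_neq0); rewrite -/delta -/tau => -[bE].
set h := (X in X * _ = _) => quad.
have -> : eta (twist_longitude n) 0 0 = h * corner m^-1 y.
  rewrite /twist_longitude etaM eta_w eta_wstar bE mulmx22 mxE /=.
  by rewrite /h /tau /commutator_trace /delta /corner invrK; field.
by rewrite mulrAC quad mulN1r addNr.
Qed.

End Evaluation.

(** * From two matrices to a representation, and the eigenvalue pairs *)

Definition letter_mx (K : fieldType) (S T : 'M[K]_2) (x : letter) : 'M[K]_2 :=
  let g := if x.1 is gen_s then S else T in if x.2 then g^-1 else g.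

Definition word_mx (K : fieldType) (S T : 'M[K]_2) (u : word) : 'M[K]_2 :=
  \prod_(x <- u) letter_mx S T x.

Section WordMx.

Variables (K : fieldType) (S T : 'M[K]_2).
Hypotheses (detS : \det S = 1) (detT : \det T = 1).

Lemma letter_mx_det x : \det (letter_mx S T x) = 1.
Proof.
by case: x => [[] []]; rewrite /letter_mx /= ?det_inv ?detS ?detT ?invr1.
Qed.

Lemma word_mx_det u : \det (word_mx S T u) = 1.
Proof.
elim: u => [|x u IHu]; rewrite /word_mx ?big_nil ?det1 //.
by rewrite big_cons det_mulmx letter_mx_det mul1r.
Qed.

Lemma word_mx_unit u : word_mx S T u \is a GRing.unit.
Proof. by rewrite -[_ \is a _]/(_ \in unitmx) unitmxE word_mx_det unitr1. Qed.

Lemma word_mxM u v : word_mx S T (u ++ v) = word_mx S T u * word_mx S T v.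
Proof. exact: big_cat. Qed.

Lemma word_mx1 x : word_mx S T [:: x] = letter_mx S T x.
Proof. exact: big_seq1. Qed.

Lemma word_mxV u : word_mx S T (winv u) = (word_mx S T u)^-1.
Proof.
elim: u => [|x u IHu]; first by rewrite /word_mx !big_nil invr1.
rewrite -cat1s [winv _]rev_cons -cats1 !word_mxM invrM ?word_mx_unit //.
rewrite -[word_mx S T (rev _)]/(word_mx S T (winv u)) IHu; congr (_ * _).
rewrite !word_mx1; case: x => g [|] //=.
by rewrite /letter_mx /= invrK.
Qed.

End WordMx.

(** For given m, only y is free in the images of s and t; conversely each root y of the Riley
    polynomial defines a representation by [word_mx]. *)
Lemma eigenvalue_pairP (K : fieldType) (n : int) (l m : K) :
  eigenvalue_pair n l m <->
  m != 0 /\ exists y, riley ((m - m^-1) ^+ 2) y n = 0 /\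
                      l * corner m y + corner m^-1 y = 0.
Proof.
split=> [[eta [y [[eta_det etaM etaV etaR] _ eta_s eta_t ->]]]|[m0 [y [r0 lE]]]].
  have m0 : m != 0.
    apply: contraPneq (eta_det ws) => m0.
    by rewrite eta_s det_mx22 m0 !mul0r mulr0 subr0; apply/eqP;
      rewrite eq_sym oner_eq0.
  have r0 := (relatorP m0 eta_det etaM etaV eta_s eta_t n).1 etaR.
  split=> //; exists y; split=> //.
  exact: (longitude_corner m0 eta_det etaM etaV eta_s eta_t r0).
pose S := mx22 m 1 0 m^-1; pose T := mx22 m 0 y m^-1.
have detS : \det S = 1 by rewrite det_mx22 mulr0 subr0 mulfV.
have detT : \det T = 1 by rewrite det_mx22 mul0r subr0 mulfV.
have eta_s : word_mx S T ws = S by rewrite word_mx1.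
have eta_t : word_mx S T wt = T by rewrite word_mx1.
have eta_det := word_mx_det detS detT.
have etaM := word_mxM S T; have etaV := word_mxV detS detT.
have c0 := riley_root_corner_neq0 m0 r0.
have lE' := longitude_corner m0 eta_det etaM etaV eta_s eta_t r0.
exists (word_mx S T), y; split=> //.
- by split=> //; apply: (relatorP m0 eta_det etaM etaV eta_s eta_t n).2 r0.
(* If S and T commuted, then y = 0 and m^-1 = m, so [corner m y] would vanish. *)
- exists ws, wt; rewrite eta_s eta_t -[_ *m _]/(S * T) -[T *m S]/(T * S).
  rewrite !mulmx22 => /mx22_inj[/eqP E1 /eqP E2 _ _].
  have y0 : y = 0.
    by apply/eqP; move: E1; rewrite -subr_eq0; congr (_ == 0); ring.
  move/negP: c0; apply; rewrite /corner y0.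
  by move: E2; rewrite -subr_eq0; congr (_ == 0); ring.
(* Both sides solve the same linear equation, whose coefficient [corner m y] is nonzero. *)
- by apply/(mulIf c0)/(addIr (corner m^-1 y)); rewrite lE lE'.
Qed.

(** * The recursion and the Riley polynomial *)

Section APolynomials.

Variable R : comNzRingType.
Implicit Types L M : R.

Definition twist_Au L M : R :=
  1 - L + 2 * L * M ^+ 2 + M ^+ 4 + 2 * L * M ^+ 4 + L ^+ 2 * M ^+ 4
    + 2 * L * M ^+ 6 - L * M ^+ 8 + L ^+ 2 * M ^+ 8.

(** Under the substitution for y this becomes b^(k-1) U_k(tau) with b = M^2 (1 + L M^2)^2. *)
Definition twist_T L M : nat -> R :=
  lucas (twist_Au L M) (M ^+ 4 * (1 + L * M ^+ 2) ^+ 4).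

(* Up to a unit and powers of b = M^2 (1 + L M^2)^2, this is the Riley polynomial
   at y = (M^2 - 1) (L - 1) / (1 + L M^2); see [twist_A_riley]. *)
Definition twist_A L M (n : int) : R :=
  match n with
  | Posz k => (1 + L * M ^+ 2) * (1 + L * M ^+ 6) * twist_T L M k
              - twist_T L M k.+1
  | Negz k => (1 + L * M ^+ 6) * twist_T L M k.+1
              - M ^+ 4 * (1 + L * M ^+ 2) ^+ 3 * twist_T L M k
  end.

Lemma twist_TSS L M k :
  twist_T L M k.+2 = twist_Au L M * twist_T L M k.+1
    - M ^+ 4 * (1 + L * M ^+ 2) ^+ 4 * twist_T L M k.
Proof. by []. Qed.

Lemma twist_A_PoszSS L M (k : nat) :
  twist_A L M k.+2 = twist_Au L M * twist_A L M k.+1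
    - M ^+ 4 * (1 + L * M ^+ 2) ^+ 4 * twist_A L M k.
Proof.
rewrite /twist_A (twist_TSS _ _ k.+1) (twist_TSS _ _ k).
by move: (twist_T _ _ k.+1) (twist_T _ _ k) (twist_Au _ _) => x y z; ring.
Qed.

Lemma twist_A_NegzSS L M (k : nat) :
  twist_A L M (Negz k.+2) = twist_Au L M * twist_A L M (Negz k.+1)
    - M ^+ 4 * (1 + L * M ^+ 2) ^+ 4 * twist_A L M (Negz k).
Proof.
rewrite /twist_A (twist_TSS _ _ k.+1) (twist_TSS _ _ k).
by move: (twist_T _ _ k.+1) (twist_T _ _ k) (twist_Au _ _) => x y z; ring.
Qed.

Lemma twist_A0 L M : twist_A L M 0 = -1.
Proof. by rewrite /twist_A /twist_T /=; ring. Qed.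

Lemma twist_A1 L M :
  twist_A L M 1 = L - L * M ^+ 2 - M ^+ 4 - 2 * L * M ^+ 4 - L ^+ 2 * M ^+ 4
                  - L * M ^+ 6 + L * M ^+ 8.
Proof. by rewrite /twist_A /twist_T /= /twist_Au; ring. Qed.

Lemma twist_AN1 L M : twist_A L M (- 1) = 1 + L * M ^+ 6.
Proof. by rewrite /twist_A /twist_T /=; ring. Qed.

Lemma twist_AN2 L M :
  twist_A L M (- 2) =
    1 - L + 2 * L * M ^+ 2 + 2 * L * M ^+ 4 + L ^+ 2 * M ^+ 4
    - L ^+ 2 * M ^+ 6 - L * M ^+ 8 + L * M ^+ 10 + 2 * L ^+ 2 * M ^+ 10
    + 2 * L ^+ 2 * M ^+ 12 - L ^+ 2 * M ^+ 14 + L ^+ 3 * M ^+ 14.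
Proof. by rewrite /twist_A /twist_T /= /twist_Au; ring. Qed.

End APolynomials.

Lemma rmorph_lucas (R S : comNzRingType) (f : {rmorphism R -> S}) (a b : R)
    (k : nat) :
  f (lucas a b k) = lucas (f a) (f b) k.
Proof.
suff: f (lucas a b k) = lucas (f a) (f b) k /\
      f (lucas a b k.+1) = lucas (f a) (f b) k.+1 by case.
elim: k => [|k [IH IH1]]; first by rewrite /= rmorph0 rmorph1.
by split=> //; rewrite !lucasSS rmorphB !rmorphM IH IH1.
Qed.

Lemma rmorph_twist_A (R S : comNzRingType) (f : {rmorphism R -> S}) (L M : R)
    (n : int) :
  f (twist_A L M n) = twist_A (f L) (f M) n.
Proof.
have fT k : f (twist_T L M k) = twist_T (f L) (f M) k.
  by rewrite /twist_T rmorph_lucas /twist_Au; congr lucas; ring.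
by case: n => k; rewrite /twist_A rmorphB !rmorphM !fT; congr (_ * _ - _); ring.
Qed.

(** Homogeneity of Lucas sequences: U_k(b tau, b^2) = b^(k-1) U_k(tau, 1). The extra factor [b] in
    the first part avoids the exponent k-1. *)
Lemma lucas_scale (R : comNzRingType) (b tau : R) (k : nat) :
  b * lucas (b * tau) (b ^+ 2) k = b ^+ k * lucas tau 1 k /\
  lucas (b * tau) (b ^+ 2) k.+1 = b ^+ k * lucas tau 1 k.+1.
Proof.
elim: k => [|k [IH IH1]]; first by rewrite /= !mulr0 mulr1.
split; first by rewrite IH1 exprS mulrA.
rewrite lucasSS IH1 [lucas tau 1 k.+2]lucasSS expr2 -!mulrA IH !exprS.
by move: (lucas _ _ k.+1) (lucas _ _ k) => x y; ring.
Qed.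

Lemma riley_Negz (R : comNzRingType) (delta y : R) (k : nat) :
  let tau := commutator_trace delta y in
  riley delta y (Negz k) =
    (1 + y + delta) * lucas tau 1 k.+1 - lucas tau 1 k.
Proof.
move=> tau; rewrite /riley -/tau; case: k => [|k]; first by rewrite /=; ring.
rewrite NegzD1 /chebyshev.
by move: (lucas _ _ k.+2) (lucas _ _ k.+1) => x z; ring.
Qed.

Lemma riley_Posz (R : comNzRingType) (delta y : R) (k : nat) :
  let tau := commutator_trace delta y in
  riley delta y k = lucas tau 1 k.+1 - (1 + y + delta) * lucas tau 1 k.
Proof. by rewrite /riley -PoszD addn1. Qed.

(** This inverts the Moebius map from y to L; the result stays multiplied out because
    [1 + l * m ^+ 2] may vanish. *)
Lemma corner_eq (K : fieldType) (l m y : K) : m != 0 ->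
  l * corner m y + corner m^-1 y = 0 <->
  y * (1 + l * m ^+ 2) = (m ^+ 2 - 1) * (l - 1).
Proof.
move=> m0.
have E : (l * corner m y + corner m^-1 y) * m =
    y * (1 + l * m ^+ 2) - (m ^+ 2 - 1) * (l - 1).
  by rewrite /corner invrK; field.
split=> [/(congr1 ( *%R^~ m))|/eqP].
  by rewrite E mul0r => /eqP; rewrite subr_eq0 => /eqP.
by rewrite -subr_eq0 -E mulf_eq0 (negPf m0) orbF => /eqP.
Qed.

(** Three substitutions suffice: [twist_Au] is b tau, [1 + l * m ^+ 6] is m^2 Q (1 + y + delta), and
    the second Lucas parameter is b^2. *)
Lemma twist_A_riley (K : fieldType) (l m y : K) (n : int) : m != 0 ->
  y * (1 + l * m ^+ 2) = (m ^+ 2 - 1) * (l - 1) ->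
  let b := m ^+ 2 * (1 + l * m ^+ 2) ^+ 2 in
  twist_A l m n =
    (match n with
     | Posz k => - b ^+ k
     | Negz k => b ^+ k * (m ^+ 2 * (1 + l * m ^+ 2))
     end) * riley ((m - m^-1) ^+ 2) y n.
Proof.
move=> m0 yE; set delta := (m - m^-1) ^+ 2; set Q := 1 + l * m ^+ 2 => b.
pose tau := commutator_trace delta y.
have AuE : twist_Au l m = b * tau.
  (* Written as a quadratic form in [Q] and (m^2 - 1)(l - 1), the latter being y Q by hypothesis. *)
  rewrite (_ : twist_Au l m = (m ^+ 2 - 1) ^+ 2 * Q * ((m ^+ 2 - 1) * (l - 1))
      + m ^+ 2 * ((m ^+ 2 - 1) * (l - 1)) ^+ 2 + 2 * m ^+ 2 * Q ^+ 2).
    by rewrite -yE -/Q /b /tau /commutator_trace /delta; field.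
  by rewrite /twist_Au /Q; ring.
have lmE : 1 + l * m ^+ 6 = m ^+ 2 * Q * (1 + y + delta).
  rewrite (_ : 1 + l * m ^+ 6 = m ^+ 2 * ((m ^+ 2 - 1) * (l - 1))
      + (m ^+ 4 - m ^+ 2 + 1) * Q).
    by rewrite -yE -/Q /delta; field.
  by rewrite /Q; ring.
have bE : m ^+ 4 * Q ^+ 4 = b ^+ 2 by rewrite /b; ring.
case: n => k; rewrite /twist_A -/Q /twist_T -/Q AuE bE lmE (lucas_scale b tau k).2.
- rewrite (_ : Q * _ = (1 + y + delta) * b); last by rewrite /b; ring.
  by rewrite -mulrA (lucas_scale b tau k).1 riley_Posz -/tau; ring.
- rewrite (_ : m ^+ 4 * Q ^+ 3 = m ^+ 2 * Q * b); last by rewrite /b; ring.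
  by rewrite -(mulrA _ b) (lucas_scale b tau k).1 riley_Negz -/tau; ring.
Qed.

(** * Degrees and leading coefficients *)

(** [c] may be zero, so that sums and products need no side condition on cancellation. *)
Definition has_top (R : nzRingType) (p : {poly R}) (d : nat) (c : R) : Prop :=
  (size p <= d.+1)%N /\ p`_d = c.

Section HasTop.

Variable R : comNzRingType.
Implicit Types (p q : {poly R}) (c : R).

Lemma has_top_size p d c : has_top p d c -> c != 0 -> size p = d.+1.
Proof.
move=> [sp pd] c0; apply/eqP; rewrite eqn_leq sp /= ltnNge.
by apply: contra c0 => sp'; rewrite -pd nth_default.
Qed.

Lemma has_top_lead_coef p d c : has_top p d c -> c != 0 -> lead_coef p = c.
Proof. by move=> pd c0; rewrite lead_coefE (has_top_size pd c0) pd.2. Qed.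

Lemma has_topW p d e c : has_top p d c -> (d < e)%N -> has_top p e 0.
Proof.
move=> [sp _] de; split; first exact: leq_trans sp (leqW de).
by rewrite nth_default // (leq_trans sp de).
Qed.

Lemma has_topC c : has_top c%:P 0 c.
Proof. by split; rewrite ?coefC // size_polyC; case: (c != 0). Qed.

Lemma has_topCXn c k : has_top (c%:P * 'X^k) k c.
Proof.
split; last by rewrite coefCM coefXn eqxx mulr1.
apply: leq_trans (size_polyMleq _ _) _; rewrite size_polyXn size_polyC.
by case: (c != 0) => //=; rewrite leqW.
Qed.

Lemma has_topD p q d a b :
  has_top p d a -> has_top q d b -> has_top (p + q) d (a + b).
Proof.
move=> [sp <-] [sq <-]; split; last by rewrite coefD.
by rewrite (leq_trans (size_polyD _ _)) // geq_max sp sq.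
Qed.

Lemma has_topN p d a : has_top p d a -> has_top (- p) d (- a).
Proof. by move=> [sp <-]; split; rewrite ?size_polyN ?coefN. Qed.

Lemma has_topM p q d e a b :
  has_top p d a -> has_top q e b -> has_top (p * q) (d + e) (a * b).
Proof.
move=> [sp <-] [sq <-]; split.
  apply: leq_trans (size_polyMleq _ _) _.
  by have := leq_add sp sq; rewrite addSn addnS; case: (size p + size q)%N.
have lt_d : (d < (d + e).+1)%N by rewrite ltnS leq_addr.
rewrite coefM (bigD1 (Ordinal lt_d)) //= addKn big1 ?addr0 // => i.
rewrite -val_eqE /= neq_ltn => /orP[] id.
  by rewrite [q`__]nth_default ?mulr0 // (leq_trans sq) // ltn_subRL ltn_add2r.
by rewrite nth_default ?mul0r // (leq_trans sp).
Qed.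

End HasTop.

(** Both the degree of A_2n in L and that of the Riley polynomial in y: 2n for n >= 0, and -2n-1 for
    n < 0. *)
Definition twist_degree (n : int) : nat :=
  match n with Posz k => k.*2 | Negz k => k.*2.+1 end.

(** Top coefficients satisfy x_(k+2) = (M^4 + M^8) x_(k+1) - M^12 x_k, with characteristic roots M^4
    and M^8; the initial values select M^4 for n >= 0 and M^8 for n < 0. *)
Lemma twist_A_top (R : comNzRingType) (n : int) :
  has_top (twist_A 'X 'Y n : {poly {poly R}}) (twist_degree n)
    (match n with
     | Posz k => - 'X^(4 * k)
     | Negz k => 'X^(8 * k + 6)
     end).
Proof.
have AuE : has_top (twist_Au 'X 'Y : {poly {poly R}}) 2 ('X^4 + 'X^8).
  (* Collected by powers of L: ['X] is M under [%:P] and L outside. *)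
  rewrite (_ : twist_Au _ _ = (1 + 'X^4)%:P
      + (- 1 + 2 * 'X^2 + 2 * 'X^4 + 2 * 'X^6 - 'X^8)%:P * 'X^1
      + ('X^4 + 'X^8)%:P * 'X^2); last by rewrite /twist_Au; ring.
  rewrite -['X^4 + 'X^8 in X in has_top _ _ X]add0r; apply: has_topD (has_topCXn _ _).
  rewrite -[0]addr0.
  apply: has_topD; [exact: has_topW (has_topC _) _ | exact: has_topW (has_topCXn _ _) _].
have WE : has_top ('Y ^+ 4 * (1 + 'X * 'Y ^+ 2) ^+ 4 : {poly {poly R}}) 4 'X^12.
  rewrite (_ : _ * _ = ('X^4)%:P + (4 * 'X^6)%:P * 'X^1 + (6 * 'X^8)%:P * 'X^2
      + (4 * 'X^10)%:P * 'X^3 + ('X^12)%:P * 'X^4); last by ring.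
  rewrite -['X^12 in X in has_top _ _ X]add0r; apply: has_topD (has_topCXn _ _).
  rewrite -[0]addr0; apply: has_topD; last exact: has_topW (has_topCXn _ _) _.
  rewrite -[0]addr0; apply: has_topD; last exact: has_topW (has_topCXn _ _) _.
  rewrite -[0]addr0; apply: has_topD; last exact: has_topW (has_topCXn _ _) _.
  exact: has_topW (has_topC _) _.
case: n => k.
  suff: has_top (twist_A 'X 'Y k : {poly {poly R}}) k.*2 (- 'X^(4 * k)) /\
    has_top (twist_A 'X 'Y k.+1 : {poly {poly R}}) k.+1.*2 (- 'X^(4 * k.+1)) by case.
  elim: k => [|k [IH IH1]].
    rewrite twist_A0 twist_A1; split.
      by have := has_topC (-1 : {poly R}); rewrite polyCN.
    rewrite (_ : _ + _ = (- 'X^4)%:P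
      + (1 - 'X^2 - 2 * 'X^4 - 'X^6 + 'X^8)%:P * 'X^1
      + (- 'X^4)%:P * 'X^2); last by ring.
    rewrite -[X in has_top _ _ X]add0r; apply: has_topD (has_topCXn _ _).
    rewrite -[0]addr0.
    apply: has_topD; first exact: has_topW (has_topC _) _.
    exact: has_topW (has_topCXn _ _) _.
  split=> //; rewrite twist_A_PoszSS.
  rewrite (_ : - 'X^_ = ('X^4 + 'X^8) * - 'X^(4 * k.+1) + - ('X^12 * - 'X^(4 * k))).
    by apply: has_topD; [exact: has_topM AuE IH1 | exact/has_topN/(has_topM WE IH)].
  by rewrite !mulnS !exprD; ring.
suff: has_top (twist_A 'X 'Y (Negz k) : {poly {poly R}}) k.*2.+1 ('X^(8 * k + 6)) /\
    has_top (twist_A 'X 'Y (Negz k.+1) : {poly {poly R}}) k.+1.*2.+1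
      ('X^(8 * k.+1 + 6)) by case.
elim: k => [|k [IH IH1]].
  rewrite twist_AN1 twist_AN2; split.
    rewrite (_ : _ + _ = 1%:P + ('X^6)%:P * 'X^1); last by ring.
    rewrite -[X in has_top _ _ X]add0r; apply: has_topD (has_topCXn _ _).
    exact: has_topW (has_topC _) _.
  rewrite (_ : _ + _ = 1%:P
      + (- 1 + 2 * 'X^2 + 2 * 'X^4 - 'X^8 + 'X^10)%:P * 'X^1
      + ('X^4 - 'X^6 + 2 * 'X^10 + 2 * 'X^12 - 'X^14)%:P * 'X^2
      + ('X^14)%:P * 'X^3); last by ring.
  rewrite -[X in has_top _ _ X]add0r; apply: has_topD (has_topCXn _ _).
  rewrite -[0]addr0; apply: has_topD; last exact: has_topW (has_topCXn _ _) _.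
  rewrite -[0]addr0; apply: has_topD; last exact: has_topW (has_topCXn _ _) _.
  exact: has_topW (has_topC _) _.
split=> //; rewrite twist_A_NegzSS.
rewrite (_ : 'X^_ = ('X^4 + 'X^8) * 'X^(8 * k.+1 + 6) + - ('X^12 * 'X^(8 * k + 6))).
  by apply: has_topD; [exact: has_topM AuE IH1 | exact/has_topN/(has_topM WE IH)].
by rewrite !mulnS !exprD; ring.
Qed.

(** At M = 0 the recursion loses its second term and [twist_Au] becomes 1 - L. This supplies a
    coefficient 1 or -1 of A_2n modulo M. *)
Lemma twist_A_M0 (R : comNzRingType) (L : R) (n : int) :
  twist_A L 0 n =
    match n with
    | Posz 0 => -1
    | Posz k.+1 => L * (1 - L) ^+ k
    | Negz k => (1 - L) ^+ k
    end.
Proof.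
have T0 k : twist_T L 0 k.+1 = (1 - L) ^+ k.
  have Au0 : twist_Au L 0 = 1 - L by rewrite /twist_Au; ring.
  have W0 : 0 ^+ 4 * (1 + L * 0 ^+ 2) ^+ 4 = 0 :> R by ring.
  elim: k => [|k IHk]; first by rewrite expr0.
  by rewrite twist_TSS IHk Au0 W0 exprS mul0r subr0.
case: n => [[|k]|k]; first exact: twist_A0.
  by rewrite /twist_A !T0 !expr0n exprS /=; ring.
by rewrite /twist_A !T0 !expr0n /=; ring.
Qed.

(** The trace is monic quadratic in y, so U_(k+1) is monic of degree 2k. The degree agrees with that
    of A_2n in L, as the root count requires. *)
Lemma riley_top (R : comNzRingType) (delta : R) (n : int) :
  has_top (riley delta%:P 'X n) (twist_degree n) 1.
Proof.
have tauE : has_top (commutator_trace delta%:P 'X) 2 1.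
  rewrite (_ : commutator_trace _ _ = 2%:P + delta%:P * 'X^1 + 1%:P * 'X^2).
    rewrite -[X in has_top _ _ X]add0r; apply: has_topD (has_topCXn _ _).
    rewrite -[0]addr0; apply: has_topD; last exact: has_topW (has_topCXn _ _) _.
    exact: has_topW (has_topC _) _.
  by rewrite /commutator_trace; ring.
have linE : has_top (1 + 'X + delta%:P) 1 1.
  rewrite (_ : _ + _ = (1 + delta)%:P + 1%:P * 'X^1); last by ring.
  rewrite -[X in has_top _ _ X]add0r; apply: has_topD (has_topCXn _ _).
  exact: has_topW (has_topC _) _.
set tau := commutator_trace _ _ in tauE.
have U k : has_top (lucas tau 1 k.+1) k.*2 1 /\ has_top (lucas tau 1 k) k.*2 0.
  elim: k => [|k [IH1 IH]]; first by split; exact: has_topC.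
  split; last exact: has_topW IH1 _.
  rewrite lucasSS mul1r; have IH' := has_topW IH (leqnSn k.*2.+1).
  by have := has_topD (has_topM tauE IH1) (has_topN IH'); rewrite mulr1 subr0.
case: n => k; rewrite ?riley_Posz ?riley_Negz -/tau.
  have top0 : has_top ((1 + 'X + delta%:P) * lucas tau 1 k) k.*2 0.
    case: k => [|k]; first by rewrite mulr0; exact: has_topC.
    exact: has_topW (has_topM linE (U k).1) _.
  by have := has_topD (U k).1 (has_topN top0); rewrite subr0.
have top0 := has_topW (U k).2 (leqnn k.*2.+1).
by have := has_topD (has_topM linE (U k).1) (has_topN top0); rewrite mulr1 subr0.
Qed.

(** * Generic separability *)

Lemma exists_notin (K : numFieldType) (s : seq K) : exists x, x \notin s.
Proof.
pose t := [seq i%:R | i <- iota 0 (size s).+1] : seq K.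
have t_uniq : uniq t.
  by rewrite map_inj_uniq ?iota_uniq // => i j /eqP; rewrite eqr_nat => /eqP.
have : ~~ all [in s] t.
  apply/negP => /allP /(uniq_leq_size t_uniq).
  by rewrite size_map size_iota ltnn.
by move/allPn => [x _ xs]; exists x.
Qed.

Lemma closed_quadratic_root (K : closedFieldType) (b c : K) :
  exists x, x ^+ 2 = b * x + c.
Proof.
have [x xE] := @solve_monicpoly K 2%N (nth 0 [:: c; b]) isT.
by exists x; rewrite xE !big_ord_recl big_ord0 /= mulr1 addr0 addrC.
Qed.

Lemma riley_PoszSS (R : comNzRingType) (delta y : R) (k : nat) :
  riley delta y k.+2 =
    commutator_trace delta y * riley delta y k.+1 - riley delta y k.
Proof.
rewrite !riley_Posz (lucasSS _ _ k.+1) (lucasSS _ _ k).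
by move: (commutator_trace _ _) (lucas _ _ k.+1) (lucas _ _ k) => u v w; ring.
Qed.

Lemma riley_NegzSS (R : comNzRingType) (delta y : R) (k : nat) :
  riley delta y (Negz k.+2) =
    commutator_trace delta y * riley delta y (Negz k.+1) - riley delta y (Negz k).
Proof.
rewrite !riley_Negz (lucasSS _ _ k.+1) (lucasSS _ _ k).
by move: (commutator_trace _ _) (lucas _ _ k.+1) (lucas _ _ k) => u v w; ring.
Qed.

(* delta = -4 is m^2 = -1, where the representations are binary dihedral. *)
Lemma riley_dihedral (K : fieldType) (q : K) (n : int) : q != 0 ->
  (q + 1) * q ^+ twist_degree n * riley (- 4) ((q + 1) ^+ 2 / q) n =
  q ^+ (twist_degree n).*2.+1 + 1.
Proof.
move=> q0; set y := (q + 1) ^+ 2 / q.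
(* Here tau = q^2 + q^-2, and q^(d+1) + q^(-d) satisfies the recursion with this trace when d
   advances by 2. *)
have tauE : q ^+ 2 * commutator_trace (- 4) y = q ^+ 4 + 1.
  by rewrite /commutator_trace /y; field.
pose P n := (q + 1) * q ^+ twist_degree n * riley (- 4) y n =
  q ^+ (twist_degree n).*2.+1 + 1.
have step (d : nat) (r r' r'' : K) :
  (q + 1) * q ^+ d * r = q ^+ d.*2.+1 + 1 ->
  (q + 1) * q ^+ d.+2 * r' = q ^+ d.+2.*2.+1 + 1 ->
  r'' = commutator_trace (- 4) y * r' - r ->
  (q + 1) * q ^+ d.+4 * r'' = q ^+ d.+4.*2.+1 + 1.
  move=> E E' ->.
  transitivity (q ^+ 2 * commutator_trace (- 4) y * ((q + 1) * q ^+ d.+2 * r')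
     - q ^+ 4 * ((q + 1) * q ^+ d * r)); first by rewrite !exprS; ring.
  by rewrite tauE E E' !doubleS !exprS; ring.
case: n => k.
  suff: P k /\ P k.+1 by case.
  elim: k => [|k [IH IH1]].
    by rewrite /P !riley_Posz /commutator_trace /y /=; split; field.
  by split=> //; apply: (step _ _ _ _ IH IH1); exact: riley_PoszSS.
suff: P (Negz k) /\ P (Negz k.+1) by case.
elim: k => [|k [IH IH1]].
  by rewrite /P !riley_Negz /commutator_trace /y /=; split; field.
by split=> //; apply: (step _ _ _ _ IH IH1); exact: riley_NegzSS.
Qed.

(** Clearing denominators makes identities in (q + 1)^2 / q polynomial in q. *)
Lemma homogenize (K : fieldType) (p : {poly K}) (e : nat) :
  (size p <= e.+1)%N ->
  exists h : {poly K}, forall q, q != 0 -> h.[q] = q ^+ e * p.[(q + 1) ^+ 2 / q].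
Proof.
move=> sp.
exists (\sum_(i < e.+1) p`_i *: (('X + 1) ^+ (2 * i) * 'X^(e - i))) => q q0.
rewrite (horner_coef_wide _ sp) mulr_sumr horner_sum; apply: eq_bigr => i _.
rewrite hornerZ hornerM horner_exp hornerXn hornerD hornerX hornerC.
rewrite expr_div_n -exprM.
have -> : q ^+ e = q ^+ (e - i) * q ^+ i by rewrite -exprD subnK // -ltnS.
move: (expf_neq0 i q0); move: (q ^+ i) (q ^+ _) ((q + 1) ^+ _) => u v w u0.
by field.
Qed.

(* A double root z would give the square of q^2 + (2 - z) q + 1 as a factor of
   q^(2d+1) + 1, which has only simple roots. *)
Lemma dihedral_separable (K : numClosedFieldType) (p : {poly K}) (d : nat) :
  size p = d.+1 ->
  (forall q, q != 0 ->
     (q + 1) * q ^+ d * p.[(q + 1) ^+ 2 / q] = q ^+ d.*2.+1 + 1) ->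
  separable_poly p.
Proof.
move=> sp pE; have p0 : p != 0 by rewrite -size_poly_gt0 sp.
rewrite separable_poly.unlock /coprimep.
apply/negPn/negP => /closed_rootP[z]; rewrite root_gcd => /andP[].
move=> /factor_theorem[p1 p1E] /rootP pz.
have /factor_theorem[s sE] : root p1 z.
  apply/rootP; move: pz; rewrite p1E derivM derivXsubC mulr1 hornerD hornerM.
  by rewrite hornerXsubC subrr mulr0 add0r.
have pE2 : p = s * ('X - z%:P) ^+ 2 by rewrite p1E sE expr2 mulrA.
have s0 : s != 0 by apply: contraNneq p0 => s0; rewrite pE2 s0 mul0r.
have [e se] : exists e, size s = e.+1.
  by exists (size s).-1; rewrite prednK // size_poly_gt0.
have dE : d = e.+2.
  apply/eqP; rewrite -eqSS -sp pE2 size_Mmonic ?monic_exp ?monicXsubC //.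
  by rewrite size_exp_XsubC se addnC.
have [h hE] := homogenize (eq_leq se).
pose evalE := (hornerD, hornerN, hornerM, hornerXn, horner_exp, hornerX, hornerC,
  hornerZ).
(* G(q) / q is the value of ['X - z%:P] at (q + 1)^2 / q, so the double root z contributes G^2. *)
pose G : {poly K} := ('X + 1) ^+ 2 - z *: 'X.
have FE : 'X^(d.*2.+1) + 1 = G * (G * (('X + 1) * h)).
  apply/eqP; rewrite -subr_eq0; apply/eqP.
  apply: (@poly_infinite_roots_eq0 _ _ (fun q => q != 0)) => [t|q q0].
    have [x] := exists_notin (0 :: t); rewrite inE negb_or => /andP[x0 xt].
    by exists x.
  rewrite /G !evalE hE // -pE // dE pE2 !evalE.
  by move: (s.[_]) => u; rewrite !exprS; field.
have [q0 q0E] := closed_quadratic_root (z - 2) (- 1).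
have q0_neq0 : q0 != 0.
  apply: contra_eq_neq q0E => ->.
  by rewrite expr0n mulr0 add0r eq_sym oppr_eq0 oner_eq0.
have G0 : G.[q0] = 0.
  rewrite /G !evalE; transitivity (q0 ^+ 2 - ((z - 2) * q0 - 1)); first by ring.
  by rewrite q0E subrr.
(* At the root q0 of G the derivative of the right side vanishes, while that of the left is (2d+1)
   q0^(2d), nonzero in characteristic 0. *)
have /(congr1 (horner^~ q0)) := congr1 (@deriv K) FE.
rewrite derivM hornerD !hornerM G0 !mul0r mulr0 addr0 derivD derivXn.
rewrite derivC addr0 hornerMn hornerXn -mulr_natl => /eqP.
by rewrite mulf_eq0 pnatr_eq0 /= expf_eq0 (negPf q0_neq0) andbF.
Qed.

Lemma rmorph_riley (R S : comNzRingType) (f : {rmorphism R -> S}) (delta y : R)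
    (n : int) :
  f (riley delta y n) = riley (f delta) (f y) n.
Proof.
have fL k : f (lucas (commutator_trace delta y) 1 k) =
    lucas (commutator_trace (f delta) (f y)) 1 k.
  by rewrite rmorph_lucas rmorph1 /commutator_trace; congr lucas; ring.
by case: n => k; rewrite ?riley_Posz ?riley_Negz rmorphB rmorphM !fL;
  congr (_ - _ * _) || congr (_ * _ - _); ring.
Qed.

(** [D] is the resultant of the Riley polynomial and its y-derivative, which is nonzero because it
    is so at delta = -4. *)
Lemma riley_generic_separable (K : numClosedFieldType) (n : int) :
  exists2 D : {poly K}, D != 0 &
    forall delta, D.[delta] != 0 -> separable_poly (riley delta%:P 'X n).
Proof.
(* Degree 0 is separate: the derivative then has no nonzero leading coefficient to survive
   specialization. *)
have [d0|d_gt0] := posnP (twist_degree n).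
  exists 1; first exact: oner_neq0.
  move=> delta _; have [s1 lc] := riley_top delta n; rewrite d0 in s1 lc.
  by rewrite [riley _ _ _]size1_polyC // lc separable_poly.unlock coprime1p.
pose r : {poly {poly K}} := riley 'X%:P 'X n.
have rmap delta : map_poly (horner_eval delta) r = riley delta%:P 'X n.
  by rewrite /r rmorph_riley /= map_polyC map_polyX /= /horner_eval hornerX.
have rtop := riley_top ('X : {poly K}) n; rewrite -/r in rtop.
have r_lead : lead_coef r = 1 by rewrite (has_top_lead_coef rtop) ?oner_neq0.
have nK : ((twist_degree n)%:R : {poly K}) != 0.
  by rewrite -polyC_natr polyC_eq0 pnatr_eq0 -lt0n.
have r'_lead : lead_coef r^`() = (twist_degree n)%:R.
  apply: (@has_top_lead_coef _ _ (twist_degree n).-1) => //; split.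
    rewrite prednK // -ltnS -(has_top_size rtop (oner_neq0 _)) lt_size_deriv //.
    by rewrite -lead_coef_eq0 r_lead oner_neq0.
  by rewrite coef_deriv prednK // rtop.2.
have resE delta :
    (resultant r r^`()).[delta] != 0 <-> separable_poly (riley delta%:P 'X n).
  rewrite -[_.[delta]]/(horner_eval delta _) map_resultant.
  - rewrite -deriv_map rmap resultant_eq0 separable_poly.unlock /coprimep.
    rewrite -leqNgt eqn_leq size_poly_gt0 gcdp_eq0 negb_and.
    rewrite -size_poly_gt0 (has_top_size (riley_top delta n) (oner_neq0 _)) /=.
    by rewrite andbT.
  - by rewrite r_lead rmorph1 oner_neq0.
  - by rewrite r'_lead rmorph_nat pnatr_eq0 -lt0n.
exists (resultant r r^`()) => [|delta /resE //].
have : (resultant r r^`()).[- 4] != 0.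
  apply/resE; apply: (@dihedral_separable _ _ (twist_degree n)).
    exact: has_top_size (riley_top _ _) (oner_neq0 _).
  move=> q q0; rewrite -riley_dihedral //; congr (_ * _).
  rewrite -[_.[_]]/(horner_eval _ _) rmorph_riley /= /horner_eval.
  by rewrite hornerC hornerX.
by apply: contraNneq => ->; rewrite horner0.
Qed.

Lemma separable_roots (K : closedFieldType) (p : {poly K}) : separable_poly p ->
  exists rs : seq K,
    [/\ uniq rs, size rs = (size p).-1 & forall z, z \in rs -> p.[z] = 0].
Proof.
move=> sep; have [rs pE] := closed_field_poly_normal p; exists rs.
have p0 : lead_coef p != 0 by rewrite lead_coef_eq0 separable_poly_neq0.
split.
- by move: sep; rewrite pE (eqp_separable (eqp_scale _ p0)) separable_prod_XsubC.
- by rewrite pE size_scale // size_prod_XsubC.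
- move=> z; rewrite -root_prod_XsubC pE => /rootP.
  by rewrite hornerZ => ->; rewrite mulr0.
Qed.

(** Only finitely many delta are bad: the roots of [D], the values coming from [s], and 0 and -4,
    where m^2 = 1 or m^2 = -1. For the others, distinct roots y give distinct eigenvalues. *)
Lemma eigenvalue_pair_generic (K : numClosedFieldType) (n : int) (s : seq K) :
  exists2 m, m \notin s & m != 0 /\ exists rs : seq K,
    [/\ uniq rs, size rs = twist_degree n
      & forall l, l \in rs -> eigenvalue_pair n l m].
Proof.
have [D D0 sepD] := riley_generic_separable K n.
have [Dr DE] := closed_field_poly_normal D.
pose f (z : K) := (z - z^-1) ^+ 2.
have [delta] := exists_notin (0 :: - 4 :: map f s ++ Dr).
rewrite !inE mem_cat !negb_or => /and4P[delta0 delta4 delta_s delta_D].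
have /sepD/separable_roots[ys [ys_uniq ys_size ysE]] : D.[delta] != 0.
  by rewrite DE hornerZ mulf_neq0 ?lead_coef_eq0 // -rootE root_prod_XsubC.
(* This solves m - 1/m = [sqrtC delta]. *)
have [m mE] := closed_quadratic_root (sqrtC delta) 1.
have m0 : m != 0.
  by apply: contra_eq_neq mE => ->; rewrite expr0n mulr0 add0r eq_sym oner_eq0.
have fm : f m = delta.
  rewrite /f -[RHS]sqrtCK; congr (_ ^+ 2); apply: (mulIf m0).
  by rewrite mulrBl mulVf // -expr2 mE addrK.
have m2_neq1 : m ^+ 2 - 1 != 0.
  apply: contraNneq delta0 => m2; rewrite -fm /f.
  have -> : m - m^-1 = (m ^+ 2 - 1) / m by field.
  by rewrite m2 mul0r expr0n.
have m2_neqN1 : 1 + m ^+ 2 != 0.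
  apply: contraNneq delta4 => m2; rewrite -fm /f -subr_eq0 opprK.
  have -> : (m - m^-1) ^+ 2 + 4 = (1 + m ^+ 2) ^+ 2 / m ^+ 2 by field.
  by rewrite m2 expr0n mul0r.
exists m; first by apply: contra delta_s => ms; rewrite -fm map_f.
split=> //.
have ys_root y : y \in ys -> riley ((m - m^-1) ^+ 2) y n = 0.
  move=> /ysE <-; rewrite -[_.[y]]/(horner_eval y _) rmorph_riley /= /horner_eval.
  by rewrite hornerC hornerX -fm.
pose ell y := - corner m^-1 y / corner m y.
have ellE y : y \in ys -> ell y * corner m y + corner m^-1 y = 0.
  by move=> /ys_root/(riley_root_corner_neq0 m0) c0; rewrite mulfVK // addNr.
exists (map ell ys); split.
(* Equal eigenvalues l give y = y' unless 1 + l m^2 = 0; that would force l = 1 and m^2 = -1. *)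
- rewrite map_inj_in_uniq // => y y' /ellE /(corner_eq _ _ m0) E.
  move=> /ellE /(corner_eq _ _ m0) E' Ell; rewrite -Ell -E in E'.
  apply: (mulIf _ (esym E')); apply: contraNneq m2_neqN1 => Q0.
  move/eqP: E; rewrite Q0 mulr0 eq_sym mulf_eq0 (negPf m2_neq1) subr_eq0 /=.
  by move/eqP=> l1; rewrite l1 mul1r in Q0; rewrite Q0.
- by rewrite size_map ys_size (has_top_size (riley_top delta n) (oner_neq0 _)).
- move=> _ /mapP[y ys_y ->]; apply/eigenvalue_pairP; split=> //.
  by exists y; split; [exact: ys_root | exact: ellE].
Qed.

(** * Identification of the A-polynomials *)

Lemma twist_A_eigenvalue_pair (K : fieldType) (n : int) (l m : K) :
  eigenvalue_pair n l m -> twist_A l m n = 0.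
Proof.
move=> /eigenvalue_pairP[m0 [y [r0 /(corner_eq _ _ m0) E]]].
by rewrite (twist_A_riley n m0 E) r0 mulr0.
Qed.

Lemma twist_A_is_A_polynomial (K : numClosedFieldType) (n : int) :
  is_A_polynomial K n (twist_A 'X 'Y n).
Proof.
set A := twist_A _ _ _.
have evalA (l m : K) : (map_poly (map_poly intr) A).[l, m] = twist_A l m n.
  rewrite horner2E -[_.[l]]/(horner_eval l _) !rmorph_twist_A /=.
  rewrite !(map_polyX, map_polyC) /=.
  by rewrite !(map_polyX, map_polyC) /= /horner_eval !(hornerX, hornerC).
have top := twist_A_top int n.
have lead0 : (match n with
    | Posz k => - 'X^(4 * k)
    | Negz k => 'X^(8 * k + 6)
    end : {poly int}) != 0.
  by case: (n) => k; rewrite ?oppr_eq0 -size_poly_eq0 size_polyXn.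
have lead := has_top_lead_coef top lead0.
have A0 i : A`_i`_0 = (twist_A 'X 0 n : {poly int})`_i.
  have <- : map_poly (horner_eval 0) A = twist_A 'X 0 n.
    by rewrite rmorph_twist_A /= map_polyX map_polyC /= /horner_eval hornerX.
  by rewrite coef_map /= /horner_eval horner_coef0.
have [N [u leadE]] : exists N (u : bool), lead_coef A = (-1) ^+ u * 'X^N.
  rewrite lead; case: (n) => k; first by exists (4 * k)%N, true; rewrite mulN1r.
  by exists (8 * k + 6)%N, false; rewrite mul1r.
(* At M = 0 the lowest term in L is -1 for n = 0, L for n > 0 and 1 for n < 0. *)
have [i [v A0E]] : exists i (v : bool), A`_i`_0 = (-1) ^+ v.
  have pow0 k : ((1 - 'X) ^+ k : {poly int})`_0 = 1.
    by rewrite -horner_coef0 horner_exp hornerD hornerN hornerX hornerC subr0 expr1n.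
  case: {+}(n) A0 => [[|k]|k] A0.
  - by exists 0%N, true; rewrite A0 twist_A0 coefN coefC.
  - by exists 1%N, false; rewrite A0 twist_A_M0 coefXM /= pow0.
  - by exists 0%N, false; rewrite A0 twist_A_M0 pow0.
apply: (is_A_polynomial_criterion leadE A0E).
  by move=> l m /twist_A_eigenvalue_pair; rewrite evalA.
move=> s; have [m ms [m0 [rs [rs_uniq rs_size rsD]]]] := eigenvalue_pair_generic n s.
exists m => //; split=> //; exists rs; split=> //.
by rewrite rs_size (has_top_size top lead0).
Qed.

(* A n stands for A_{2n}, the A-polynomial of the twist knot T_{2n}. *)
Theorem theorem1p2 (R : realType) :
  let L : {poly {poly int}} := 'X in
  let M : {poly {poly int}} := 'Y in
  let Au : {poly {poly int}} :=
    1 - L + 2 * L * M ^+ 2 + M ^+ 4 + 2 * L * M ^+ 4 + L ^+ 2 * M ^+ 4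
      + 2 * L * M ^+ 6 - L * M ^+ 8 + L ^+ 2 * M ^+ 8 in
  exists A : int -> {poly {poly int}},
    (forall n : int, is_A_polynomial R[i] n (A n)) /\
    (forall n : int, 1 < n ->
       A n = Au * A (n - 1) - M ^+ 4 * (1 + L * M ^+ 2) ^+ 4 * A (n - 2)) /\
    (forall n : int, n < -2 ->
       A n = Au * A (n + 1) - M ^+ 4 * (1 + L * M ^+ 2) ^+ 4 * A (n + 2)) /\
    A (-2) = 1 - L + 2 * L * M ^+ 2 + 2 * L * M ^+ 4 + L ^+ 2 * M ^+ 4
             - L ^+ 2 * M ^+ 6 - L * M ^+ 8 + L * M ^+ 10
             + 2 * L ^+ 2 * M ^+ 10 + 2 * L ^+ 2 * M ^+ 12
             - L ^+ 2 * M ^+ 14 + L ^+ 3 * M ^+ 14 /\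
    A (-1) = 1 + L * M ^+ 6 /\
    A 0 = -1 /\
    A 1 = L - L * M ^+ 2 - M ^+ 4 - 2 * L * M ^+ 4 - L ^+ 2 * M ^+ 4
          - L * M ^+ 6 + L * M ^+ 8.
Proof.
move=> L M Au; exists (twist_A L M); split; last split; last split; last split.
- by move=> n; exact: twist_A_is_A_polynomial.
- case=> [[|[|k]]|k] // _.
  rewrite (_ : k.+2%:Z - 1 = k.+1); last by rewrite subzSS subr0.
  rewrite (_ : k.+2%:Z - 2 = k); last by rewrite !subzSS subr0.
  exact: twist_A_PoszSS.
- case=> [k|[|[|k]]] // _.
  rewrite -[2]/(1 + 1) addrA !NegzD1; exact: twist_A_NegzSS.
- exact: twist_AN2.
- split; last split; [exact: twist_AN1 | exact: twist_A0 | exact: twist_A1].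
Qed.
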